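(* For $m<n$ and the space of $n$ qubits $\mathcal{Q}_n=\mathcal{Q}_{n-m}\otimes\mathcal{Q}_m$, relativized to $m$ and $n$, for semi-density matrices $\sigma,\rho$ on $\mathcal{Q}_n$, $\mathbf{d}(\mathrm{Tr}_{\mathcal{Q}_m}\sigma|\mathrm{Tr}_{\mathcal{Q}_m}\rho)<^{+}\mathbf{d}(\sigma|\rho)$.
   Context: $\mathcal{Q}_k$ is the Hilbert space of $k$ qubits and $\mathrm{Tr}_{\mathcal{Q}_m}$ the partial trace over the factor $\mathcal{Q}_m$. $U$ is a fixed universal prefix Turing machine and $\mathbf{m}(x/y)=\sum_p 2^{-\|p\|}[U_y(p)=x]$ the universal probability. A program $q$ lower computes a positive semidefinite matrix $\sigma$ if $U(q)$ outputs an increasing sequence of elementary (rational-entry) semi-density matrices converging to $\sigma$; $\underline{\mathbf{m}}(\sigma/x)=\sum\{\mathbf{m}(q/x): q\text{ lower computes }\sigma\}$. For semi-density $\rho$, $\mathcal{T}_\rho$ is the set of lower computable matrices $\nu$ with $\mathrm{Tr}\,\nu\rho\le1$, $\mathfrak{T}_\rho=\sum_{\nu\in\mathcal{T}_\rho}\underline{\mathbf{m}}(\nu/n)\nu$, and $\mathbf{d}(\sigma|\rho)=\log\mathrm{Tr}\,\mathfrak{T}_\rho\sigma$ is the deficiency of randomness. $f<^{+}g$ means $f<g+O(1)$; ''relativized to $m$ and $n$'' means these are given to $U$ on an auxiliary tape.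
   Formalization: Lower computing uses increasing elementary positive semidefinite matrices without the trace bound of semi-density matrices (with it the claim fails, as Tr νρ ≤ 1 is vacuous); Tr 𝔗_ρσ is taken termwise in [0,∞], as 𝔗_ρ may then diverge. *)

(* Defs.v *)
From HB Require Import structures.
From mathcomp Require Import all_boot all_order all_algebra spectral.
From mathcomp Require Import complex.
From mathcomp Require Import all_classical all_reals all_analysis.

Set Implicit Arguments.
Unset Strict Implicit.
Unset Printing Implicit Defensive.

Import Order.TTheory GRing.Theory Num.Theory.
Import numFieldNormedType.Exports.

Local Open Scope classical_set_scope.
Local Open Scope ring_scope.

(* Self-delimiting Turing machines: a one-way program tape of bits (only
   accessible through [Read]), a two-way read-only auxiliary tape of bits,
   finitely many two-way work tapes over a finite alphabet, and a one-way
   write-only output tape of bits. The auxiliary and work tapes are infinite to the right; moving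
   left from cell 0 leaves the head in place. *)
Variant move := MoveL | Stay | MoveR.

Definition shift (d : move) (i : nat) : nat :=
  match d with MoveL => i.-1 | Stay => i | MoveR => i.+1 end.

Variant action (state tape sym : finType) :=
  | Halt
  | Read of state & state
  | Step of state & move & {ffun tape -> sym} & (tape -> move) & option bool.
Arguments Halt {state tape sym}.
Arguments Read {state tape sym}.
Arguments Step {state tape sym}.

(* [delta s a w]: [a] is the scanned auxiliary bit ([None] on a blank cell) and
   [w] the scanned symbols of the work tapes. [Read s0 s1] consumes one
   program bit and branches on it; [Step s d w' dw o] writes [w'], moves the
   heads and appends the bit [o], if any, to the output. *)
Record machine := Machine {
  state : finType;
  tape : finType;
  sym : finType;
  blank : sym;
  start : state;
  delta : state -> option bool -> {ffun tape -> sym} -> action state tape sym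
}.

Record config (M : machine) := Config {
  cstate : state M;
  caux : nat;
  cwork : tape M -> nat -> sym M;
  chead : tape M -> nat;
  cprog : seq bool; (* the unread part of the program *)
  cout : seq bool
}.

Section Run.
Variables (M : machine) (y : seq bool).
Implicit Types c : config M.

Definition init (p : seq bool) : config M :=
  Config (start M) 0 (fun _ _ => blank M) (fun _ => 0%N) p [::].

Definition caction c : action (state M) (tape M) (sym M) :=
  delta (cstate c) (onth y (caux c)) [ffun k => cwork c k (chead c k)].

(* A machine that tries to read past the end of its program waits forever. *)
Definition step c : config M :=
  match caction c with
  | Halt => c
  | Read s0 s1 =>
      if cprog c is b :: p then
        Config (if b then s1 else s0) (caux c) (cwork c) (chead c) p (cout c)
      else c
  | Step s d w dw o =>
      Config s (shift d (caux c))
        (fun k i => if i == chead c k then w k else cwork c k i)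
        (fun k => shift (dw k) (chead c k))
        (cprog c) (if o is Some b then rcons (cout c) b else cout c)
  end.

Definition halted c : bool := if caction c is Halt then true else false.

Definition run (p : seq bool) (t : nat) : config M := iter t step (init p).

(* M_y(p) = x : M halts with output x having read exactly p. *)
Definition computes (p x : seq bool) : Prop :=
  exists t, [/\ halted (run p t), cprog (run p t) = [::] & cout (run p t) = x].

(* w is an initial segment of the (possibly infinite) output of M_y on p,
   whether or not M halts. *)
Definition emits (p w : seq bool) : Prop :=
  exists t, prefix w (cout (run p t)).

End Run.

Section PrefixFree.
Variables (M : machine) (y : seq bool).
Definition extend_prog (s : seq bool) (c : config M) :=
  Config (cstate c) (caux c) (cwork c) (chead c) (cprog c ++ s) (cout c).
Lemma step_ext s c : step y c <> c -> step y (extend_prog s c) = extend_prog s (step y c).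
Proof.
rewrite /step /extend_prog /caction /=; case: (delta _ _ _) => [//|s0 s1|] //.
by case: (cprog c).
Qed.
Lemma halted_step (c : config M) : halted y c -> step y c = c.
Proof. by rewrite /halted /step; case: caction. Qed.
Lemma run_ext p s t : halted y (run M y p t) ->
  exists2 t', (t' <= t)%N & run M y (p ++ s) t' = extend_prog s (run M y p t).
Proof.
suff H : forall t (c : config M), halted y (iter t (step y) c) ->
  exists2 t', (t' <= t)%N & iter t' (step y) (extend_prog s c) = extend_prog s (iter t (step y) c).
  by move=> h; apply: (H t (init M p)).
elim=> [|n IH] c; first by exists 0.
rewrite iterSr => h.
have [e|ne] := pselect (step y c = c).
  rewrite e in h *; have [t' lt e'] := IH _ h; exists t' => //; exact: leqW.
have [t' lt e'] := IH _ h; exists t'.+1 => //.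
by rewrite iterSr step_ext.
Qed.
Lemma computes_prefix_free p s x x' : computes M y p x -> computes M y (p ++ s) x' -> s = [::].
Proof.
move=> [t [h ep _]] [u [h' ep' _]].
have [t' _ e] := @run_ext p s t h.
have hs : halted y (run M y (p ++ s) t') by rewrite e.
have st (c : config M) k : halted y c -> iter k (step y) c = c.
  by move=> hc; elim: k => //= k ->; exact: halted_step.
have : run M y (p++s) t' = run M y (p++s) u.
  rewrite -(st _ u hs) -(st _ t' h') /run -!iterD addnC //.
by move=> e2; move: ep'; rewrite -e2 e /= ep.
Qed.
End PrefixFree.

Definition universal (U : machine) : Prop :=
  forall T : machine, exists t : seq bool, forall y p : seq bool,
    (forall x, computes U y (t ++ p) x <-> computes T y p x) /\
    (forall w, emits U y (t ++ p) w <-> emits T y p w).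

Definition code_nat (n : nat) : seq bool := rcons (nseq n true) false.

Definition code_int (z : int) : seq bool := (z < 0) :: code_nat `|z|%N.

Definition code_rat (r : rat) : seq bool :=
  code_int (numq r) ++ code_nat `|denq r|%N.

Definition code_seq (T : Type) (f : T -> seq bool) (s : seq T) : seq bool :=
  rcons (flatten [seq true :: f x | x <- s]) false.

(* (x, y) : rat * rat stands for the complex number x + iy. *)
Definition code_mx (N : nat) (A : 'M[rat * rat]_N) : seq bool :=
  code_seq (code_seq (fun z : rat * rat => code_rat z.1 ++ code_rat z.2))
    [seq [seq A i j | j <- enum 'I_N] | i <- enum 'I_N].

Section Quantum.
Variable R : realType.

Definition elementary_mx (N : nat) (A : 'M[rat * rat]_N) : 'M[R[i]]_N :=
  map_mx (fun z : rat * rat => Complex (ratr z.1) (ratr z.2)) A.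

Definition psdmx (N : nat) (A : 'M[R[i]]_N) : Prop :=
  A \is hermsymmx /\
  forall v : 'rV[R[i]]_N, 0 <= (v *m A *m map_mx Num.conj v^T) 0 0.

Definition semidensity (N : nat) (A : 'M[R[i]]_N) : Prop :=
  psdmx A /\ \tr A <= 1.

Definition mx_cvg (N : nat) (s : nat -> 'M[R[i]]_N) (A : 'M[R[i]]_N) : Prop :=
  forall i j,
    (fun l => complex.Re (s l i j)) @ \oo --> complex.Re (A i j) /\
    (fun l => complex.Im (s l i j)) @ \oo --> complex.Im (A i j).

(* In what follows, e is the content of the auxiliary tape to which everything
   is relativized. The approximations are elementary positive semidefinite
   matrices without any bound on the trace: bounding it by 1 would turn the
   condition Tr (nu rho) <= 1 in [tests] into a vacuous one. *)
Definition lower_computes (U : machine) (e q : seq bool) (N : nat)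
    (sigma : 'M[R[i]]_N) : Prop :=
  exists s : nat -> 'M[rat * rat]_N,
    [/\ forall l, emits U e q (flatten [seq code_mx (s i) | i <- iota 0 l]),
        forall l, psdmx (elementary_mx (s l)),
        forall l, psdmx (elementary_mx (s l.+1) - elementary_mx (s l)) &
        mx_cvg (fun l => elementary_mx (s l)) sigma].

Definition univ_prob (U : machine) (x y : seq bool) : \bar R :=
  \esum_(p in [set p | computes U y p x]) ((2 ^- size p)%:E)%E.

Definition lower_prob (U : machine) (e : seq bool) (N : nat)
    (sigma : 'M[R[i]]_N) (y : seq bool) : \bar R :=
  \esum_(q in [set q | lower_computes U e q sigma]) univ_prob U q (e ++ y).

Definition tests (U : machine) (e : seq bool) (N : nat) (rho : 'M[R[i]]_N) :
    set 'M[R[i]]_N :=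
  [set nu | (exists q, lower_computes U e q nu) /\ \tr (nu *m rho) <= 1].

(* Tr (T_rho sigma) for T_rho = \sum_(nu in tests rho) m(nu / k) nu. The trace is
   taken termwise because the sum diverges in some directions when rho is
   singular. *)
Definition trace_test (U : machine) (e : seq bool) (k : nat)
    (sigma rho : 'M[R[i]]_(2 ^ k)) : \bar R :=
  \esum_(nu in tests U e rho)
    (lower_prob U e nu (code_nat k) * (complex.Re (\tr (nu *m sigma)))%:E)%E.

(* The binary logarithm, with values -oo at 0 and +oo at +oo. *)
Definition deficiency (U : machine) (e : seq bool) (k : nat)
    (sigma rho : 'M[R[i]]_(2 ^ k)) : \bar R :=
  (lne (trace_test U e sigma rho) * ((ln 2)^-1)%:E)%E.

Lemma tensor_dim (m n : nat) : (m <= n)%N -> (2 ^ (n - m) * 2 ^ m = 2 ^ n)%N.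
Proof. by move=> le_mn; rewrite -expnD subnK. Qed.

(* Basis vector |i> (x) |a> of Q_(n-m) (x) Q_m = Q_n; its index is i * 2 ^ m + a. *)
Definition tensor_index (m n : nat) (le_mn : (m <= n)%N)
    (i : 'I_(2 ^ (n - m))) (a : 'I_(2 ^ m)) : 'I_(2 ^ n) :=
  cast_ord (tensor_dim le_mn) (mxvec_index i a).

Definition partial_trace (m n : nat) (le_mn : (m <= n)%N)
    (A : 'M[R[i]]_(2 ^ n)) : 'M[R[i]]_(2 ^ (n - m)) :=
  \matrix_(i, j) \sum_a A (tensor_index le_mn i a) (tensor_index le_mn j a).

End Quantum.

(* Main.v *)
(* A test nu for the reduced state Tr_m rho yields the test nu (x) I for rho,
   since Tr ((nu (x) I) sigma) = Tr (nu Tr_m sigma) for every sigma. It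
   therefore suffices that nu (x) I has, up to a constant factor, at least
   the universal probability of nu. Two machines, each running a small
   program around U, give this. Given q that lower computes nu, the first
   one rewrites the output of U on q, a stream of codes of matrices A,
   into the codes of the matrices A (x) I; as U is universal, t ++ q lower
   computes nu (x) I for a fixed t. The second one runs U with n - m in
   place of n on the auxiliary tape, and outputs t before the output of U;
   hence U(p) = q given n - m implies U(t' ++ p) = t ++ q given n, for a
   fixed t', and the constant is the length of t'. *)

Require Import Defs.
From mathcomp Require Import all_boot all_order all_algebra.
From mathcomp Require Import complex mxtens.
From mathcomp Require Import all_classical all_reals all_analysis.

Set Implicit Arguments.
Unset Strict Implicit.
Unset Printing Implicit Defensive.

Import Order.TTheory GRing.Theory Num.Theory.
Import numFieldNormedType.Exports.

Fixpoint reads (T : Type) (v : nat -> option T) (k : nat) (s : seq T) : Prop :=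
  if s is x :: s' then v k = Some x /\ reads v k.+1 s' else True.

Lemma reads_cons T (v : nat -> option T) k x s :
  reads v k (x :: s) <-> v k = Some x /\ reads v k.+1 s.
Proof. by []. Qed.

Lemma reads_cat T (v : nat -> option T) k s1 s2 :
  reads v k (s1 ++ s2) <-> reads v k s1 /\ reads v (k + size s1) s2.
Proof.
elim: s1 k => [|x s1 IH] k /=; first by rewrite addn0; split=> [|[]].
by rewrite -addSnnS; split=> [[e /IH[]]|[[e h1] h2]] //; split; last exact/IH.
Qed.

Lemma reads_rcons T (v : nat -> option T) k s x :
  reads v k (rcons s x) <-> reads v k s /\ v (k + size s) = Some x.
Proof.
by rewrite -cats1; split=> [/reads_cat[? []]|[? ?]] //; apply/reads_cat.
Qed.

Lemma reads_intro T (v : nat -> option T) k s :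
  (forall i, i < size s -> v (k + i) = onth s i) -> reads v k s.
Proof.
elim: s k => //= x s IH k h; split; first by rewrite -[k]addn0 h.
by apply: IH => i lti; rewrite addSnnS h.
Qed.

Lemma reads_onth T (s1 s s2 : seq T) : reads (onth (s1 ++ s ++ s2)) (size s1) s.
Proof.
apply: reads_intro => i lti.
by rewrite onth_cat ltnNge leq_addr /= addKn onth_cat lti.
Qed.

Lemma reads_onth0 T (s s' : seq T) : reads (onth (s ++ s')) 0 s.
Proof. exact: (@reads_onth _ [::]). Qed.

Lemma onth_size T (s : seq T) : onth s (size s) = None.
Proof. exact: onth_default. Qed.

Lemma onth_rcons T (s : seq T) x i :
  onth (rcons s x) i = if i == size s then Some x else onth s i.
Proof.
rewrite -cats1 onth_cat; case: ltngtP => // [lti|->]; last by rewrite subnn.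
by rewrite !onth_default ?subn_gt0 // ltnW.
Qed.

Definition reach (M : machine) (y : seq bool) (c c' : config M) : Prop :=
  exists t, iter t (step y) c = c'.

Lemma reach_refl M y (c : config M) : reach y c c.
Proof. by exists 0. Qed.

Lemma reach_step M y (c c' : config M) : reach y c c' -> reach y c (step y c').
Proof. by move=> [t <-]; exists t.+1. Qed.

(** * Programs *)

Section Programs.
Variable K : nat.

Variant op := Emit of bool | Write of bool | Inc of 'I_K | TapeLeft | AuxLeft.

(* Every test consumes what it looks at: [NextAux] and [NextBit] move past the
   bit that they read, and [Count k] decrements a nonzero counter. *)
Variant test := NextAux | NextBit | Count of 'I_K | Always.

Inductive cmd :=
  | Skip
  | Do of op
  | Seq of cmd & cmd
  | If of test & cmd & cmd
  | While of test & cmd.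

Record store := Store {
  saux : nat;
  scells : nat -> option bool;
  spos : nat;
  scnt : seq nat;
  sout : seq bool
}.

Definition exec_op (o : op) (s : store) : store :=
  let: Store a v i c w := s in
  match o with
  | Emit b => Store a v i c (rcons w b)
  | Write b => Store a (fun j => if j == i then Some b else v j) i.+1 c w
  | Inc k => Store a v i (incr_nth c k) w
  | TapeLeft => Store a v i.-1 c w
  | AuxLeft => Store a.-1 v i c w
  end.

Variable y : seq bool.

Definition exec_test (t : test) (s : store) : option (bool * store) :=
  let: Store a v i c w := s in
  match t with
  | NextAux => omap (pair^~ (Store a.+1 v i c w)) (onth y a)
  | NextBit => omap (pair^~ (Store a v i.+1 c w)) (v i)
  | Count k =>
      if nth 0 c k is n.+1 then Some (true, Store a v i (set_nth 0 c k n) w)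
      else Some (false, s)
  | Always => Some (true, s)
  end.

Inductive exec : cmd -> store -> store -> Prop :=
  | ExecSkip s : exec Skip s s
  | ExecDo o s : exec (Do o) s (exec_op o s)
  | ExecSeq c1 c2 s1 s2 s3 :
      exec c1 s1 s2 -> exec c2 s2 s3 -> exec (Seq c1 c2) s1 s3
  | ExecIf t c1 c2 b s1 s2 s3 :
      exec_test t s1 = Some (b, s2) -> exec (if b then c1 else c2) s2 s3 ->
      exec (If t c1 c2) s1 s3
  | ExecWhileFalse t c s1 s2 :
      exec_test t s1 = Some (false, s2) -> exec (While t c) s1 s2
  | ExecWhileTrue t c s1 s2 s3 s4 :
      exec_test t s1 = Some (true, s2) -> exec c s2 s3 ->
      exec (While t c) s3 s4 -> exec (While t c) s1 s4.

Variant instr := Act of op | Branch of test & nat | Goto of nat.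

Fixpoint compile (k : nat) (c : cmd) : seq instr :=
  match c with
  | Skip => [::]
  | Do o => [:: Act o]
  | Seq c1 c2 => let C1 := compile k c1 in C1 ++ compile (k + size C1) c2
  | If t c1 c2 =>
      let C1 := compile k.+1 c1 in
      let l := (k.+1 + size C1).+1 in
      let C2 := compile l c2 in
      Branch t l :: C1 ++ Goto (l + size C2) :: C2
  | While t c =>
      let C := compile k.+1 c in Branch t (k.+1 + size C).+1 :: rcons C (Goto k)
  end.

Definition exec_instr (i : instr) (k : nat) (s : store) :
    option (nat * store) :=
  match i with
  | Act o => Some (k.+1, exec_op o s)
  | Branch t l =>
      omap (fun bs => (if bs.1 then k.+1 else l, bs.2)) (exec_test t s)
  | Goto l => Some (l, s)
  end.

Section Compile.
Variables (code : nat -> option instr) (ok : pred instr).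
Variable R : nat -> store -> Prop.
Hypothesis R_instr : forall i k s k' s', code k = Some i -> ok i ->
  exec_instr i k s = Some (k', s') -> R k s -> R k' s'.

Lemma compile_while t c k s1 s2 s3 :
  exec_test t s1 = Some (true, s2) ->
  (reads code k.+1 (compile k.+1 c) -> all ok (compile k.+1 c) ->
   R k.+1 s2 -> R (k.+1 + size (compile k.+1 c)) s3) ->
  reads code k (compile k (While t c)) -> all ok (compile k (While t c)) ->
  R k s1 -> R k s3.
Proof.
move=> e Rc /= [code_t /reads_rcons[code_c code_goto]]; rewrite all_rcons.
move=> /and3P[ok_t ok_goto ok_c] Rk.
apply: (R_instr code_goto ok_goto erefl); apply: Rc => //.
by apply: (R_instr code_t ok_t _ Rk); rewrite /= e.
Qed.

Lemma exec_compile c s s' : exec c s s' ->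
  forall k, reads code k (compile k c) -> all ok (compile k c) ->
  R k s -> R (k + size (compile k c)) s'.
Proof.
elim=> {c s s'}.
- by move=> s k _ _; rewrite addn0.
- move=> o s k /= [code_o _] /andP[ok_o _]; rewrite addn1.
  exact: R_instr code_o ok_o _.
- move=> c1 c2 s1 s2 s3 _ IH1 _ IH2 k /= /reads_cat[code1 code2].
  rewrite all_cat size_cat addnA => /andP[ok1 ok2] /(IH1 _ code1 ok1).
  exact: IH2.
- move=> t c1 c2 b s1 s2 s3 e _ IH k /=.
  set C1 := compile _ c1; set C2 := compile _ c2.
  rewrite all_cat size_cat /= => -[code_t /reads_cat[code1 [code_goto code2]]].
  move=> /and4P[ok_t ok1 ok_goto ok2] Rk; rewrite !addnS addnA -!addSn.
  have : R (if b then k.+1 else (k.+1 + size C1).+1) s2.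
    by apply: (R_instr code_t ok_t _ Rk); rewrite /= e.
  case: b IH {e} => IH /IH; last exact.
  by move=> /(_ code1 ok1); exact: R_instr code_goto ok_goto erefl.
- move=> t c s1 s2 e k /= [code_t _] /andP[ok_t _] Rk.
  by apply: (R_instr code_t ok_t _ Rk); rewrite /= e size_rcons !addnS addSn.
- move=> t c s1 s2 s3 s4 e _ IH1 _ IH2 k code_k ok_k Rk.
  apply: (IH2 k code_k ok_k); apply: (compile_while e _ code_k ok_k Rk).
  exact: IH1.
Qed.

End Compile.
End Programs.

Arguments Skip {K}.
Arguments Emit {K}.
Arguments Write {K}.
Arguments TapeLeft {K}.
Arguments AuxLeft {K}.
Arguments NextAux {K}.
Arguments NextBit {K}.
Arguments Always {K}.
Arguments Goto {K}.

Lemma config_eq (M : machine) (c c' : config M) :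
  cstate c = cstate c' -> caux c = caux c' ->
  (forall k i, cwork c k i = cwork c' k i) ->
  (forall k, chead c k = chead c' k) ->
  cprog c = cprog c' -> cout c = cout c' -> c = c'.
Proof.
case: c => ? ? w h ? ?; case: c' => ? ? w' h' ? ? /= -> -> ew eh -> ->.
by congr Config; apply/funext => k; [apply/funext => i|].
Qed.

Lemma prefix_cout_step M y (c : config M) : prefix (cout c) (cout (step y c)).
Proof.
rewrite /step; case: caction => [|s0 s1|u d w dw [b|]] /=.
- exact: prefix_refl.
- by case: (cprog c) => [|b p]; exact: prefix_refl.
- exact: prefix_rcons.
- exact: prefix_refl.
Qed.

Section OutputStream.
Variables (M : machine) (y p : seq bool).
Local Notation out t := (cout (run M y p t)).

Lemma prefix_cout_run t t' : t <= t' -> prefix (out t) (out t').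
Proof.
move=> /subnK <-; elim: (t' - t) => [|d IH]; first exact: prefix_refl.
exact: prefix_trans IH (prefix_cout_step _ _).
Qed.

Lemma onth_cout_run t t' i :
  i < size (out t) -> i < size (out t') -> onth (out t) i = onth (out t') i.
Proof.
wlog: t t' / t <= t' => [th lti lti'|].
  by case/orP: (leq_total t t') => le_tt'; [|symmetry]; exact: th.
by move=> /prefix_cout_run/prefixP[s ->] lti _; rewrite onth_cat lti.
Qed.

Definition out_stream (i : nat) : option bool :=
  if pselect (exists t, i < size (out t)) is left h
  then onth (out (xchoose h)) i else None.

Lemma out_streamE t i : i < size (out t) -> out_stream i = onth (out t) i.
Proof.
rewrite /out_stream => lti; case: pselect => [h|[]]; last by exists t.
exact: onth_cout_run (xchooseP h) lti.
Qed.

Lemma out_stream_def i b : out_stream i = Some b -> exists t, i < size (out t).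
Proof. by rewrite /out_stream; case: pselect. Qed.

Lemma reads_out_stream w : emits M y p w -> reads out_stream 0 w.
Proof.
move=> [t /prefixP[s e]]; apply: reads_intro => i lti.
by rewrite add0n (out_streamE (t := t)) e ?size_cat ?ltn_addr // onth_cat lti.
Qed.

End OutputStream.

(** * Running a program around a machine *)

Lemma update_same (T : eqType) S (v : T -> S) k :
  (fun i => if i == k then v k else v i) = v.
Proof. by apply/funext => i; case: eqP => [->|]. Qed.

Section Host.
Variables (U : machine) (K : nat) (prog : cmd K).
Let code : seq (instr K) := compile 0 prog.

Definition host_state : finType := option ('I_(size code).+1 * state U).
(* [inl None] is the tape of bits. The counter [j] is the position of the head
   on the tape [inl (Some j)], whose only nonblank cell is cell 0. *)
Definition host_tape : finType := (option 'I_K + tape U)%type.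
Definition host_sym : finType := (option bool * sym U)%type.
Local Notation host_action := (action host_state host_tape host_sym).

Section Delta.
Variables (u : state U) (w : {ffun host_tape -> host_sym}).
Let wU : {ffun tape U -> sym U} := [ffun j => (w (inr j)).2].
Let v : option bool := (w (inl None)).1.

Definition own_step (l : nat) (da : move) (v' : option bool) (dv : move)
    (dk : 'I_K -> move) (o : option bool) : host_action :=
  Step (Some (inord l, u)) da
    [ffun j : host_tape => if j is inl None then (v', blank U) else w j]
    (fun j => match j with
              | inl None => dv | inl (Some k) => dk k | inr _ => Stay
              end) o.

(* One step of U, whose output goes to the tape of bits. *)
Definition feed_step (k : 'I_(size code).+1) (a : option bool) : host_action :=
  match delta u a wU with
  | Halt => Halt
  | Read u0 u1 => Read (Some (k, u0)) (Some (k, u1))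
  | Step u' d w' dw o =>
      Step (Some (k, u')) d
        [ffun j : host_tape => match j with
                   | inl None => (if o is Some b then Some b else v, blank U)
                   | inl _ => w j
                   | inr j => (None, w' j)
                   end]
        (fun j => if j is inr j then dw j else Stay) None
  end.

(* One step of U, whose auxiliary tape is the tape of bits. *)
Definition final_step (k : 'I_(size code).+1) : host_action :=
  match delta u v wU with
  | Halt => Halt
  | Read u0 u1 => Read (Some (k, u0)) (Some (k, u1))
  | Step u' d w' dw o =>
      Step (Some (k, u')) Stay
        [ffun j : host_tape => if j is inr j then (None, w' j) else w j]
        (fun j => match j with
                  | inl None => d | inl _ => Stay | inr j => dw j
                  end) o
  end.

Definition still : 'I_K -> move := fun=> Stay.
Definition only (k : 'I_K) (d : move) : 'I_K -> move :=
  fun j => if j == k then d else Stay.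

(* At a blank cell, [NextBit] waits for U to write a bit; at the end of the
   program, U takes over. *)
Definition prog_step (k : 'I_(size code).+1) (a : option bool) : host_action :=
  match onth code k with
  | Some (Act (Emit b)) => own_step k.+1 Stay v Stay still (Some b)
  | Some (Act (Write b)) => own_step k.+1 Stay (Some b) MoveR still None
  | Some (Act (Inc j)) => own_step k.+1 Stay v Stay (only j MoveR) None
  | Some (Act TapeLeft) => own_step k.+1 Stay v MoveL still None
  | Some (Act AuxLeft) => own_step k.+1 MoveL v Stay still None
  | Some (Branch NextAux l) =>
      own_step (if a == Some true then k.+1 else l) MoveR v Stay still None
  | Some (Branch NextBit l) =>
      if v is Some b then
        own_step (if b then k.+1 else l) Stay v MoveR still None
      else feed_step k a
  | Some (Branch (Count j) l) =>
      own_step (if (w (inl (Some j))).1 == Some true then l else k.+1)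
        Stay v Stay (only j MoveL) None
  | Some (Branch Always l) => own_step k.+1 Stay v Stay still None
  | Some (Goto l) => own_step l Stay v Stay still None
  | None => final_step k
  end.

End Delta.

Definition host_delta (q : host_state) (a : option bool)
    (w : {ffun host_tape -> host_sym}) : host_action :=
  match q with
  | None => Step (Some (ord0, start U)) Stay
      [ffun j : host_tape =>
         (if j is inl (Some _) then Some true else None, blank U)]
      (fun=> Stay) None
  | Some (k, u) => prog_step u w k a
  end.

Definition host : machine :=
  Machine ((None, blank U) : host_sym) (None : host_state) host_delta.

(* [caux u] and [cout u] are replaced by [saux s] and [sout s]. *)
Definition host_config (k : nat) (u : config U) (s : store) : config host :=
  @Config host (Some (inord k, cstate u)) (saux s)
    (fun j i => match j with
       | inl None => (scells s i, blank U)
       | inl (Some _) => (if i == 0 then Some true else None, blank U)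
       | inr j => (None, cwork u j i)
       end)
    (fun j => match j with
       | inl None => spos s
       | inl (Some k) => nth 0 (scnt s) k
       | inr j => chead u j
       end) (cprog u) (sout s).

Definition start_store : store := Store 0 (onth [::]) 0 (nseq K 0) [::].

Lemma step_init y p :
  step y (init host p) = host_config 0 (init U p) start_store.
Proof.
rewrite /step /caction /=; apply: config_eq => //=.
- by congr (Some (_, _)); apply/val_inj; rewrite /= inordK.
- by move=> [[k|]|k] i; rewrite ?ffunE ?onth0n //=; case: (i == 0).
- by move=> [[k|]|k] //; rewrite nth_nseq ltn_ord.
Qed.

Definition scanned (k : nat) (u : config U) (s : store) :
    {ffun host_tape -> host_sym} :=
  [ffun j => cwork (host_config k u s) j (chead (host_config k u s) j)].

Lemma scanned_bit k u s : (scanned k u s (inl None)).1 = scells s (spos s).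
Proof. by rewrite ffunE. Qed.

Lemma scanned_mark k u s j :
  ((scanned k u s (inl (Some j))).1 == Some true) = (nth 0 (scnt s) j == 0).
Proof. by rewrite ffunE /=; case: (nth _ _ _ == 0). Qed.

Lemma scanned_work k u s :
  [ffun j => (scanned k u s (inr j)).2] = [ffun j => cwork u j (chead u j)].
Proof. by apply/ffunP => j; rewrite !ffunE. Qed.

Lemma caction_host_config y k u s : caction y (host_config k u s) =
  prog_step (cstate u) (scanned k u s) (inord k) (onth y (saux s)).
Proof. by []. Qed.

Lemma step_own y k u s l da v dv dk o s' :
  prog_step (cstate u) (scanned k u s) (inord k) (onth y (saux s)) =
    own_step (cstate u) (scanned k u s) l da v dv dk o ->
  saux s' = Defs.shift da (saux s) ->
  scells s' = (fun i => if i == spos s then v else scells s i) ->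
  spos s' = Defs.shift dv (spos s) ->
  (forall j : 'I_K, nth 0 (scnt s') j = Defs.shift (dk j) (nth 0 (scnt s) j)) ->
  sout s' = (if o is Some b then rcons (sout s) b else sout s) ->
  step y (host_config k u s) = host_config l u s'.
Proof.
move=> e ea ev ep ec eo; rewrite /step caction_host_config e /=.
apply: config_eq => //=.
- move=> [[j|]|j] i; rewrite ?ev /=; case: eqP => // ei;
    by rewrite ?ei ffunE /= ?ffunE.
- by move=> [[j|]|j].
Qed.

Lemma step_instr y k u s i k' s' :
  onth code k = Some i -> exec_instr y i k s = Some (k', s') ->
  step y (host_config k u s) = host_config k' u s'.
Proof.
move=> ei; have ek : (inord k : 'I_(size code).+1) = k :> nat.
  by rewrite inordK // ltnS ltnW // -onthTE ei.
have := erefl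
  (prog_step (cstate u) (scanned k u s) (inord k) (onth y (saux s))).
rewrite [X in _ = X -> _]/prog_step ek ei scanned_bit.
case: s => a v p c w.
case: i ei => [op|t l|l] _.
- case: op => [b|b|j||] act [<- <-];
    apply: step_own act _ _ _ _ _; rewrite /= ?update_same // => j'.
  by rewrite nth_incr_nth /only eq_sym val_eqE; case: eqP.
- case: t => [||j|] /=; rewrite ?scanned_mark /=.
  + by case ea: (onth y a) => [[]|] //= act [<- <-];
      (apply: step_own; rewrite /= ?ea; first exact: act); rewrite ?update_same.
  + by case ev: (v p) => [[]|] //= act [<- <-];
      apply: step_own act _ _ _ _ _; rewrite /= -?ev ?update_same.
  + case ec: (nth 0 c j) => [|n] /= act [<- <-];
      apply: step_own act _ _ _ _ _; rewrite /= ?update_same // => j'.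
      by rewrite /only; case: eqP => // ->; rewrite ec.
    by rewrite nth_set_nth /= val_eqE /only; case: eqP => // ->; rewrite ec.
  + by move=> act [<- <-];
      apply: step_own act _ _ _ _ _; rewrite /= ?update_same.
- by move=> act [<- <-]; apply: step_own act _ _ _ _ _; rewrite /= ?update_same.
Qed.

(* While a program reads the output of U, the auxiliary head belongs to U and
   the tape of bits holds what U has written. *)
Definition sync (u : config U) (s : store) : store :=
  Store (caux u) (onth (cout u)) (spos s) (scnt s) (sout s).

Lemma step_feed y k u s l :
  onth code k = Some (Branch NextBit l) -> spos s = size (cout u) ->
  step y (host_config k u (sync u s)) =
  host_config k (step y u) (sync (step y u) s).
Proof.
move=> ei; case: s => a v i c w /= ->.
rewrite [LHS]/step caction_host_config /prog_step inordK; last first.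
  by rewrite ltnS ltnW // -onthTE ei.
rewrite ei scanned_bit /= onth_size /feed_step scanned_work scanned_bit.
rewrite /= onth_size /step /caction.
case: delta => [|s0 s1|u' d w' dw o] //=.
  by case: (cprog u) => //= b p; case: b.
apply: config_eq => //=.
- move=> [[j|]|j] i'; case: eqP => ei'; rewrite ?ei' ?ffunE //=.
  + by case: o => [b|]; rewrite ?onth_rcons ?eqxx ?onth_size.
  + by case: o => [b|] //; rewrite onth_rcons; case: eqP ei'.
- by move=> [[j|]|j].
Qed.

Lemma step_final y y' u a cnt pre :
  step y (host_config (size code) u
            (Store a (onth y') (caux u) cnt (pre ++ cout u))) =
  host_config (size code) (step y' u)
    (Store a (onth y') (caux (step y' u)) cnt (pre ++ cout (step y' u))).
Proof.
rewrite [LHS]/step caction_host_config /prog_step inordK // onth_size.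
rewrite /final_step scanned_work scanned_bit /= /step /caction.
case: delta => [|s0 s1|u' d w' dw o] //=.
  by case: (cprog u) => //= b p; case: b.
apply: config_eq => //=.
- by move=> [[j|]|j] i; case: eqP => ei; rewrite ?ei ?ffunE.
- by move=> [[j|]|j].
- by case: o => // b; rewrite rcons_cat.
Qed.

Lemma halted_final y y' u a cnt w :
  halted y (host_config (size code) u (Store a (onth y') (caux u) cnt w)) =
  halted y' u.
Proof.
rewrite /halted caction_host_config /prog_step inordK // onth_size /final_step.
by rewrite scanned_work scanned_bit /caction /=; case: delta.
Qed.

Lemma reach_exec y u c0 c k s s' : exec y c s s' ->
  reads (onth code) k (compile k c) ->
  reach y c0 (host_config k u s) ->
  reach y c0 (host_config (k + size (compile k c)) u s').
Proof.
move=> exec_c code_k; pose R j r := reach y c0 (host_config j u r).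
apply: (exec_compile (ok := predT) (R := R) _ exec_c code_k (all_predT _)).
move=> i j r j' r' code_j _ e reach_j; rewrite /R -(step_instr u code_j e).
exact: reach_step.
Qed.

Lemma host_computes y y' p x a cnt pre :
  exec y prog start_store (Store a (onth y') 0 cnt pre) ->
  computes U y' p x -> computes host y p (pre ++ x).
Proof.
move=> exec_prog [t [halt_t prog_t out_t]].
have [t0 run_t0] : reach y (init host p)
    (host_config (size code) (init U p)
       (Store a (onth y') 0 cnt (pre ++ [::]))).
  rewrite cats0; apply: (reach_exec (k := 0) exec_prog).
    exact: reads_intro.
  by rewrite -(step_init y p); exact: reach_step (reach_refl _ _).
have run_host j : run host y p (j + t0) = host_config (size code) (run U y' p j)
    (Store a (onth y') (caux (run U y' p j)) cnt (pre ++ cout (run U y' p j))).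
  rewrite /run iterD run_t0; elim: j => //= j ->; exact: step_final.
exists (t + t0); rewrite run_host; split=> //=; last by rewrite out_t.
by rewrite halted_final.
Qed.

Section Streaming.
Variables (y p : seq bool).
Local Notation r t := (run U y p t).

Definition streaming (i : instr K) : bool :=
  match i with
  | Act (Write _) | Act AuxLeft | Branch NextAux _ => false
  | _ => true
  end.

Definition stream_reached (k : nat) (s : store) : Prop :=
  scells s = out_stream U y p /\
  exists2 t, spos s <= size (cout (r t)) &
    reach y (init host p) (host_config k (r t) (sync (r t) s)).

Lemma reach_feed k l s b :
  onth code k = Some (Branch NextBit l) -> out_stream U y p (spos s) = Some b ->
  stream_reached k s ->
  exists2 t, spos s < size (cout (r t)) &
    reach y (init host p) (host_config k (r t) (sync (r t) s)).
Proof.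
move=> code_k /out_stream_def[t1 lt1] [_ [t0 le0 reach0]].
have ex_t : exists t, spos s < size (cout (r (t + t0))).
  exists t1; apply: leq_trans lt1 (size_prefix _).
  by apply: prefix_cout_run; exact: leq_addr.
case: (ex_minnP ex_t) => t ltt min_t; exists (t + t0) => //.
suff : forall d, d <= t ->
    reach y (init host p) (host_config k (r (d + t0)) (sync (r (d + t0)) s)).
  exact.
elim=> // d IH ltd.
have e : spos s = size (cout (r (d + t0))).
  apply/eqP; rewrite eqn_leq (leq_trans le0) /=; last first.
    by apply: size_prefix; apply: prefix_cout_run; exact: leq_addl.
  by rewrite leqNgt; apply: contraL ltd => /min_t; rewrite -leqNgt.
rewrite addSn /run iterS -(step_feed _ code_k e).
exact: reach_step (IH (ltnW ltd)).
Qed.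

Definition reads_bit (i : instr K) : bool :=
  if i is Branch NextBit _ then true else false.

Lemma exec_instr_sync u i k s k' s' :
  streaming i -> exec_instr y i k s = Some (k', s') ->
  (reads_bit i -> onth (cout u) (spos s) = scells s (spos s)) ->
  [/\ exec_instr y i k (sync u s) = Some (k', sync u s'),
      scells s' = scells s & spos s' <= spos s + reads_bit i].
Proof.
case: s => a v j c w.
case: i => [[b|b|k0||]|[||k0|] l|l] //= _; rewrite ?addn0 ?addn1;
  try by case=> <- <-.
- by case=> <- <-; rewrite /= leq_pred.
- by case ev: (v j) => [b|] //= [<- <-] ->.
- by case: (nth 0 c k0) => [|n] [<- <-].
Qed.

Lemma stream_instr i k s k' s' : onth code k = Some i -> streaming i ->
  exec_instr y i k s = Some (k', s') ->
  stream_reached k s -> stream_reached k' s'.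
Proof.
move=> code_k str_i e reached; have [cells_s [t le_t reach_t]] := reached.
have [t' [le_t' reach_t' out_t']] : exists t',
    [/\ spos s + reads_bit i <= size (cout (r t')),
        reach y (init host p) (host_config k (r t') (sync (r t') s)) &
        reads_bit i -> onth (cout (r t')) (spos s) = scells s (spos s)].
  case bit_i: (reads_bit i); last by exists t; rewrite addn0.
  case: i bit_i code_k e {str_i} => [//|[] // l _ code_k e|//].
  case eb: (out_stream U y p (spos s)) => [b|]; last first.
    by move: e; case: (s) cells_s eb => a v j c w /= -> ->.
  have [t' lt_t' reach_t'] := reach_feed code_k eb reached.
  exists t'; rewrite addn1; split=> // _.
  by rewrite cells_s (out_streamE lt_t').
have [e' cells_s' le_s'] := exec_instr_sync str_i e out_t'.
split; first by rewrite cells_s'.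
exists t'; first exact: leq_trans le_t'.
by rewrite -(step_instr (r t') code_k e'); exact: reach_step.
Qed.

End Streaming.
End Host.

Lemma host_emits U K (setup body : cmd K) y p cnt (s_ : nat -> store) l :
  (forall k, all (@streaming K) (compile k body)) ->
  exec y setup (start_store K) (Store 0 (onth [::]) 0 cnt [::]) ->
  s_ 0 = Store 0 (out_stream U y p) 0 cnt [::] ->
  (forall l, exec y body (s_ l) (s_ l.+1)) ->
  emits (host U (Seq setup (While Always body))) y p (sout (s_ l)).
Proof.
move=> str_body exec_setup s0 exec_body.
set prog := Seq _ _; pose code := compile 0 prog.
pose k := size (compile 0 setup).
have [code_setup code_loop] : reads (onth code) 0 (compile 0 setup) /\
    reads (onth code) k (compile k (While Always body)).
  by have /reads_cat[] : reads (onth code) 0 code by exact: reads_intro.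
have instr_y := @stream_instr U K prog y p.
suff [_ [t _ [t' run_t']]] : stream_reached U prog y p k (s_ l).
  by exists t'; rewrite /run run_t' prefix_refl.
elim: l => [|l IH].
  rewrite s0; split=> //; exists 0 => //.
  apply: (reach_exec (k := 0) exec_setup code_setup).
  rewrite -(step_init U prog y p).
  exact: reach_step (reach_refl _ _).
apply: (compile_while instr_y (s2 := s_ l) _ _ code_loop _ IH).
- by case: (s_ l).
- move=> code_body str_code.
  exact: (exec_compile instr_y (exec_body l) code_body str_code).
- by rewrite /= all_rcons str_body.
Qed.

(** * Elementary programs *)

Local Notation "c1 ;; c2" := (Seq c1 c2) (at level 60, right associativity).

Lemma set_nth_same T (x0 : T) s i :
  i < size s -> set_nth x0 s i (nth x0 s i) = s.
Proof.
move=> lti; apply: (@eq_from_nth _ x0).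
  by rewrite size_set_nth (maxn_idPr lti).
by move=> j _; rewrite nth_set_nth /=; case: eqP => [->|].
Qed.

Section BasicPrograms.
Variables (K : nat) (y : seq bool).
Implicit Types k : 'I_K.

Lemma exec_do (o : op K) s s' : exec_op o s = s' -> exec y (Do o) s s'.
Proof. by move=> <-; exact: ExecDo. Qed.

Lemma exec_countdown k c (s_ : nat -> store) n :
  exec_test y (Count k) (s_ 0) = Some (false, s_ 0) ->
  (forall j, exists2 s, exec_test y (Count k) (s_ j.+1) = Some (true, s) &
                        exec y c s (s_ j)) ->
  exec y (While (Count k) c) (s_ n) (s_ 0).
Proof.
move=> count0 countS; elim: n => [|n IH]; first exact: ExecWhileFalse.
by have [s e exec_c] := countS n; exact: ExecWhileTrue e exec_c IH.
Qed.

Definition emit_seq (w : seq bool) : cmd K :=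
  foldr (fun b => Seq (Do (Emit b))) Skip w.

Lemma exec_emit_seq u a v i c w :
  exec y (emit_seq u) (Store a v i c w) (Store a v i c (w ++ u)).
Proof.
elim: u w => [|b u IH] w; first by rewrite cats0; exact: ExecSkip.
by rewrite -cat_rcons; apply: ExecSeq (IH _); exact: exec_do.
Qed.

Definition pour k l (u : seq bool) : cmd K :=
  While (Count k) (Do (Inc l) ;; emit_seq u).

Lemma exec_pour k l u a v i c w : k != l -> k < size c -> l < size c ->
  exec y (pour k l u) (Store a v i c w)
    (Store a v i (set_nth 0 (set_nth 0 c k 0) l (nth 0 c l + nth 0 c k))
       (w ++ flatten (nseq (nth 0 c k) u))).
Proof.
move=> ne_kl.
have ne_lk : (l == k :> nat) = false by rewrite eq_sym; exact/negbTE.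
move n_def: (nth 0 c k) => n.
elim: n c w n_def => [|n IH] c w n_def lt_k lt_l.
  have -> : set_nth 0 c k 0 = c by rewrite -{2}n_def set_nth_same.
  rewrite cats0 addn0 set_nth_same //.
  by apply: ExecWhileFalse; rewrite /= n_def.
apply: ExecWhileTrue; first by rewrite /= n_def.
  by apply: ExecSeq (exec_emit_seq _ _ _ _ _ _); exact: exec_do.
set c' := incr_nth _ _; have size_c' : size c' = size c.
  by rewrite size_incr_nth size_set_nth (maxn_idPr lt_k) lt_l.
have c'E j : nth 0 c' j = (l == j :> nat) + (if j == k then n else nth 0 c j).
  by rewrite nth_incr_nth nth_set_nth.
have -> : set_nth 0 (set_nth 0 c k 0) l (nth 0 c l + n.+1) =
    set_nth 0 (set_nth 0 c' k 0) l (nth 0 c' l + n).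
  apply: (@eq_from_nth _ 0) => [|j _]; first by rewrite !size_set_nth size_c'.
  rewrite !nth_set_nth /= !nth_set_nth /= !c'E eqxx ne_lk add1n addSnnS.
  by case: (j =P l) => // /nesym/eqP/negbTE ->; case: (j =P k).
rewrite [flatten _]/= catA; apply: IH; rewrite ?size_c' //.
by rewrite c'E ne_lk eqxx.
Qed.

Definition transfer k l : cmd K := pour k l [::].

Lemma exec_transfer k l a v i c w : k != l -> k < size c -> l < size c ->
  exec y (transfer k l) (Store a v i c w)
    (Store a v i (set_nth 0 (set_nth 0 c k 0) l (nth 0 c l + nth 0 c k)) w).
Proof.
move=> ne_kl lt_k lt_l; have := exec_pour [::] a v i w ne_kl lt_k lt_l.
suff -> : flatten (nseq (nth 0 c k) [::]) = [::] :> seq bool by rewrite cats0.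
by elim: (nth 0 c k).
Qed.

End BasicPrograms.

Lemma size_code_nat n : size (code_nat n) = n.+1.
Proof. by rewrite size_rcons size_nseq. Qed.

(** * Changing the auxiliary input *)

Section ChangeAux.
Variables (y pre : seq bool).
Local Notation skipped := (@Ordinal 2 0 isT).
Local Notation written := (@Ordinal 2 1 isT).

Definition put (b : bool) : cmd 2 := Do (Write b) ;; Do (Inc written).

Lemma exec_put b a s m w :
  exec y (put b) (Store a (onth s) (size s) [:: m; size s] w)
    (Store a (onth (rcons s b)) (size (rcons s b)) [:: m; size (rcons s b)] w).
Proof.
apply: ExecSeq (ExecDo _ _ _) _; apply: exec_do; rewrite /= size_rcons.
by congr Store; apply/funext => i; rewrite onth_rcons.
Qed.

Definition count_if (counting : bool) : cmd 2 :=
  if counting then Do (Inc skipped) else Skip.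

Lemma exec_count_if counting a v i m l w :
  exec y (count_if counting) (Store a v i [:: m; l] w)
    (Store a v i [:: m + counting; l] w).
Proof.
case: counting; first by apply: exec_do; rewrite addn1.
by rewrite addn0; exact: ExecSkip.
Qed.

Definition copy_block (counting : bool) : cmd 2 :=
  While NextAux (count_if counting ;; put true) ;; put false.

Lemma exec_copy_block counting n a s m w : reads (onth y) a (code_nat n) ->
  let s' := s ++ code_nat n in
  exec y (copy_block counting) (Store a (onth s) (size s) [:: m; size s] w)
    (Store (a + n.+1) (onth s') (size s') [:: m + counting * n; size s'] w).
Proof.
move=> /= input; rewrite -rcons_cat; apply: ExecSeq (exec_put _ _ _ _ _).
elim: n a s m input => [|n IH] a s m /= [e input].
  by rewrite cats0 muln0 !addn0 addn1; apply: ExecWhileFalse; rewrite /= e.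
apply: ExecWhileTrue; first by rewrite /= e.
  exact: ExecSeq (exec_count_if _ _ _ _ _ _ _) (exec_put _ _ _ _ _).
by rewrite mulnS addnA -cat_rcons addnS -addSn; exact: IH.
Qed.

(* The first block 1^m 0 is counted while it is copied, so that m bits of the
   third block can be skipped. *)
Definition aux_program : cmd 2 :=
  copy_block true ;; copy_block false ;;
  While (Count skipped) (If NextAux Skip Skip) ;; copy_block false ;;
  While (Count written) (Do TapeLeft) ;; emit_seq 2 pre.

Lemma exec_skip_aux m a n v i w : reads (onth y) a (nseq m true) ->
  exec y (While (Count skipped) (If NextAux Skip Skip))
    (Store a v i [:: m; n] w) (Store (a + m) v i [:: 0; n] w).
Proof.
elim: m a => [|m IH] a; first by rewrite addn0; move=> _; exact: ExecWhileFalse.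
move=> [e read_a]; rewrite addnS -addSn.
apply: ExecWhileTrue _ _ (IH _ read_a) => //.
by apply: (ExecIf (b := true)); [rewrite /= e|exact: ExecSkip].
Qed.

Lemma exec_rewind_written a v m n w :
  exec y (While (Count written) (Do TapeLeft))
    (Store a v n [:: m; n] w) (Store a v 0 [:: m; 0] w).
Proof.
apply: (exec_countdown (s_ := fun n => Store a v n [:: m; n] w)) => // j.
by eexists; [by []|exact: exec_do].
Qed.

End ChangeAux.

Lemma exec_aux_program pre m n k :
  let e := code_nat m ++ code_nat n in
  exists a, exec (e ++ code_nat (m + k)) (aux_program pre) (start_store 2)
    (Store a (onth (e ++ code_nat k)) 0 [:: 0; 0] pre).
Proof.
move=> e; pose y := e ++ code_nat (m + k); rewrite -/y.
have read_m : reads (onth y) 0 (code_nat m).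
  by rewrite /y /e -catA; exact: reads_onth0.
have read_n : reads (onth y) (0 + m.+1) (code_nat n).
  by rewrite /y /e -catA -(size_code_nat m); exact: reads_onth.
have : reads (onth y) (0 + m.+1 + n.+1) (code_nat (m + k)).
  rewrite add0n /y /e -!size_code_nat -size_cat -{1}[code_nat (m + k)]cats0.
  exact: reads_onth.
rewrite /code_nat nseqD rcons_cat => /reads_cat[read_skipped read_k].
eexists; apply: ExecSeq (exec_copy_block true [::] 0 _ read_m) _.
apply: ExecSeq (exec_copy_block false _ _ _ read_n) _.
rewrite mul1n mul0n addn0 add0n.
apply: ExecSeq (exec_skip_aux _ _ _ _ read_skipped) _.
rewrite size_nseq in read_k.
apply: ExecSeq (exec_copy_block false _ _ _ read_k) _.
apply: ExecSeq (exec_rewind_written _ _ _ _ _ _) _.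
exact: exec_emit_seq.
Qed.

Definition aux_machine (U : machine) (pre : seq bool) : machine :=
  host U (aux_program pre).

Lemma aux_machine_computes U pre m n p x : m <= n ->
  let e := code_nat m ++ code_nat n in
  computes U (e ++ code_nat (n - m)) p x ->
  computes (aux_machine U pre) (e ++ code_nat n) p (pre ++ x).
Proof.
move=> le_mn e; have [a] := exec_aux_program pre m n (n - m).
rewrite subnKC // => exec_aux; exact: host_computes exec_aux.
Qed.

(** * Transforming codes of matrices A into codes of A (x) I *)

Lemma size_cons_cat T (x : T) s1 s2 :
  size (x :: s1 ++ s2) = (size s1 + size s2).+1.
Proof. by rewrite /= size_cat. Qed.

Definition code_body (T : Type) (f : T -> seq bool) (s : seq T) : seq bool :=
  flatten [seq true :: f x | x <- s].

Lemma code_seqE T (f : T -> seq bool) s :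
  code_seq f s = rcons (code_body f s) false.
Proof. by []. Qed.

Lemma code_body_cat T (f : T -> seq bool) s1 s2 :
  code_body f (s1 ++ s2) = code_body f s1 ++ code_body f s2.
Proof. by rewrite /code_body map_cat flatten_cat. Qed.

Lemma code_body_cons T (f : T -> seq bool) x s :
  code_body f (x :: s) = true :: f x ++ code_body f s.
Proof. by []. Qed.

Lemma code_seq_cons T (f : T -> seq bool) x s :
  code_seq f (x :: s) = true :: f x ++ code_seq f s.
Proof. by rewrite /code_seq /= rcons_cat. Qed.

Definition code_entry (z : rat * rat) : seq bool :=
  code_rat z.1 ++ code_rat z.2.

Local Notation code_row := (code_seq code_entry).
Local Notation code_rows := (code_seq code_row).

(* One row of [A (x) I], made from the row [s] of [A], where [i + j + 1] is the
   dimension of [I]. *)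
Definition spread_row (i j : nat) (s : seq (rat * rat)) : seq (rat * rat) :=
  flatten [seq nseq i 0%R ++ z :: nseq j 0%R | z <- s].

Definition spread_rows (k : nat) (rows : seq (seq (rat * rat))) :
    seq (seq (rat * rat)) :=
  flatten [seq [seq spread_row i (k - i) s | i <- iota 0 k.+1] | s <- rows].

Section TensorProgram.
Local Notation left := (@Ordinal 4 0 isT).
Local Notation right := (@Ordinal 4 1 isT).
Local Notation spare := (@Ordinal 4 2 isT).
Local Notation offset := (@Ordinal 4 3 isT).

Definition zero_code : seq bool :=
  [:: false; false; true; false; false; false; true; false].

Lemma code_entry0 : code_entry 0%R = zero_code.
Proof. by rewrite /code_entry /code_rat (numq_int 0) (denq_int 0). Qed.

Definition rewind : cmd 4 := While (Count offset) (Do TapeLeft).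

Definition copy_bit : cmd 4 :=
  If NextBit (Do (Emit true)) (Do (Emit false)) ;; Do (Inc offset).

Definition copy_nat : cmd 4 :=
  While NextBit (Do (Inc offset) ;; Do (Emit true)) ;;
  Do (Inc offset) ;; Do (Emit false).

Definition copy_rat : cmd 4 := copy_bit ;; copy_nat ;; copy_nat.

Definition copy_entry : cmd 4 := copy_rat ;; copy_rat.

Definition emit_zeros (k : 'I_4) : cmd 4 :=
  pour k spare (true :: zero_code) ;; transfer spare k.

(* Row i * M + a of A (x) I_M is row i of A with each entry preceded by a zeros
   and followed by M - 1 - a zeros. The counters left and right hold these two
   numbers, and offset is the distance from the beginning of row i of A, which
   is read once for each a. *)
Definition copy_entries : cmd 4 :=
  While NextBit (Do (Inc offset) ;; emit_zeros left ;; Do (Emit true) ;;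
    copy_entry ;; emit_zeros right).

Definition copy_row : cmd 4 :=
  Do (Emit true) ;; copy_entries ;; Do (Inc offset) ;; Do (Emit false).

Definition copy_rows : cmd 4 :=
  copy_row ;;
  While (Count right) (Do (Inc left) ;; rewind ;; copy_row) ;;
  While (Count offset) Skip ;; transfer left right.

Definition tensor_matrix : cmd 4 := While NextBit copy_rows ;; Do (Emit false).

Definition double_right : cmd 4 :=
  While (Count right) (Do (Inc spare) ;; Do (Inc spare)) ;;
  transfer spare right ;; Do (Inc right).

(* Starting from 0, m iterations of r := 2 * r + 1 give 2 ^ m - 1. *)
Definition tensor_setup : cmd 4 :=
  While NextAux (Do (Inc offset) ;; double_right) ;;
  Do AuxLeft ;; While (Count offset) (Do AuxLeft).

Lemma streaming_tensor_matrix k : all (@streaming 4) (compile k tensor_matrix).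
Proof. by vm_compute. Qed.

Variable y : seq bool.

Lemma exec_double_right a v i l r p w :
  exec y double_right (Store a v i [:: l; r; 0; p] w)
    (Store a v i [:: l; r.*2.+1; 0; p] w).
Proof.
suff loop t : exec y (While (Count right) (Do (Inc spare) ;; Do (Inc spare)))
    (Store a v i [:: l; r; t; p] w) (Store a v i [:: l; 0; t + r.*2; p] w).
  apply: ExecSeq (loop 0) _; apply: ExecSeq; first exact: exec_transfer.
  exact: exec_do.
elim: r t => [|r IH] t; first by rewrite addn0; exact: ExecWhileFalse.
rewrite doubleS !addnS -!addSn; apply: ExecWhileTrue _ _ (IH _) => //.
by apply: ExecSeq (ExecDo _ _ _) (ExecDo _ _ _).
Qed.

Lemma exec_double_loop m a v i l r p w : reads (onth y) a (code_nat m) ->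
  exec y (While NextAux (Do (Inc offset) ;; double_right))
    (Store a v i [:: l; r; 0; p] w)
    (Store (a + m.+1) v i [:: l; (2 ^ m * r.+1).-1; 0; p + m] w).
Proof.
elim: m a r p => [|m IH] a r p [e input].
  by rewrite mul1n addn0 addn1; apply: ExecWhileFalse; rewrite /= e.
rewrite expnSr -mulnA mul2n doubleS (addnS a) (addnS p) -!addSn.
apply: ExecWhileTrue _ _ (IH _ _ _ input); first by rewrite /= e.
by apply: ExecSeq (exec_double_right _ _ _ _ _ _ _); exact: exec_do.
Qed.

Lemma exec_tensor_setup m : reads (onth y) 0 (code_nat m) ->
  exec y tensor_setup (start_store 4)
    (Store 0 (onth [::]) 0 [:: 0; (2 ^ m).-1; 0; 0] [::]).
Proof.
move=> input; rewrite -[2 ^ m]muln1.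
apply: ExecSeq (exec_double_loop _ _ _ _ _ _ input) _.
apply: ExecSeq (ExecDo _ _ _) _; rewrite !add0n /=.
apply: (exec_countdown
  (s_ := fun m => Store m _ _ [:: _; _; _; m] _)) => // j.
by eexists; [by []|exact: exec_do].
Qed.

Definition copies (c : cmd 4) (u : seq bool) : Prop :=
  forall a v i l r t p w, reads v i u ->
  exec y c (Store a v i [:: l; r; t; p] w)
    (Store a v (i + size u) [:: l; r; t; p + size u] (w ++ u)).

Lemma copies_seq c1 c2 u1 u2 :
  copies c1 u1 -> copies c2 u2 -> copies (c1 ;; c2) (u1 ++ u2).
Proof.
move=> copies1 copies2 a v i l r t p w.
move=> /reads_cat[/copies1 exec1 /copies2 exec2].
rewrite size_cat !addnA catA.
exact: ExecSeq (exec1 _ _ _ _ _ _) (exec2 _ _ _ _ _ _).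
Qed.

Lemma copies_bit b : copies copy_bit [:: b].
Proof.
move=> a v i l r t p w [e _]; rewrite !addn1 cats1.
apply: (ExecSeq (s2 := Store a v i.+1 [:: l; r; t; p] (rcons w b))).
  by apply: ExecIf; [by rewrite /= e|case: b {e}; exact: exec_do].
exact: exec_do.
Qed.

Lemma copies_nat n : copies copy_nat (code_nat n).
Proof.
move=> a v i l r t p w input; rewrite size_code_nat.
apply: (ExecSeq (s2 := Store a v (i + n.+1) [:: l; r; t; p + n]
                         (w ++ nseq n true))).
  elim: n i p w input => [|n IH] i p w [e input].
    by rewrite cats0 addn0 addn1; apply: ExecWhileFalse; rewrite /= e.
  rewrite -cat_rcons (addnS i) (addnS p) -!addSn.
  apply: ExecWhileTrue _ _ (IH _ _ _ input); first by rewrite /= e.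
  by apply: ExecSeq (ExecDo _ _ _) _; exact: exec_do.
by apply: ExecSeq (ExecDo _ _ _) _; apply: exec_do; rewrite /= rcons_cat !addnS.
Qed.

Lemma copies_rat q : copies copy_rat (code_rat q).
Proof.
exact: (copies_seq (@copies_bit (numq q < 0)%R)
  (copies_seq (@copies_nat `|numq q|) (@copies_nat `|denq q|))).
Qed.

Lemma copies_entry z : copies copy_entry (code_entry z).
Proof. exact: copies_seq (@copies_rat z.1) (@copies_rat z.2). Qed.

Lemma exec_emit_zeros k a v i l r p w : k != spare ->
  exec y (emit_zeros k) (Store a v i [:: l; r; 0; p] w)
    (Store a v i [:: l; r; 0; p]
       (w ++ code_body code_entry (nseq (nth 0 [:: l; r; 0; p] k) 0%R))).
Proof.
rewrite /code_body map_nseq code_entry0.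
by case: k => [[|[|[|[|]]]] //= lt_k] _;
  (apply: ExecSeq; [exact: exec_pour|exact: exec_transfer]).
Qed.

Lemma exec_rewind a v i l r t p w :
  exec y rewind (Store a v (i + p) [:: l; r; t; p] w)
    (Store a v i [:: l; r; t; 0] w).
Proof.
rewrite -{2}(addn0 i).
apply: (exec_countdown
  (s_ := fun p => Store a v (i + p) [:: l; r; t; p] w)) => // j.
by eexists; [by []|apply: exec_do; rewrite /= addnS].
Qed.

Lemma exec_drain a v i l r t p w :
  exec y (While (Count offset) Skip)
    (Store a v i [:: l; r; t; p] w) (Store a v i [:: l; r; t; 0] w).
Proof.
apply: (exec_countdown (s_ := fun p => Store a v i [:: l; r; t; p] w)) => // j.
by eexists; [by []|exact: ExecSkip].
Qed.

Lemma exec_copy_entries s a v i l r p w : reads v i (code_row s) ->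
  exec y copy_entries (Store a v i [:: l; r; 0; p] w)
    (Store a v (i + size (code_row s))
       [:: l; r; 0; p + size (code_body code_entry s)]
       (w ++ code_body code_entry (spread_row l r s))).
Proof.
elim: s i p w => [|z s IH] i p w.
  move=> [e _]; rewrite cats0 addn0 addn1.
  by apply: ExecWhileFalse; rewrite /= e.
rewrite code_seq_cons => /reads_cons[e /reads_cat[read_z /IH exec_s]].
apply: ExecWhileTrue; first by rewrite /= e.
  apply: ExecSeq; first exact: exec_do.
  apply: ExecSeq; first exact: exec_emit_zeros.
  apply: ExecSeq; first exact: exec_do.
  apply: ExecSeq; first exact: (@copies_entry z _ _ _ _ _ _ _ _ read_z).
  exact: exec_emit_zeros.
have -> : spread_row l r (z :: s) =
    nseq l 0%R ++ z :: nseq r 0%R ++ spread_row l r s.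
  by rewrite -cat_cons catA.
rewrite code_body_cat !code_body_cons code_body_cat.
move: (code_entry z) exec_s {read_z} => u exec_s.
rewrite -cat_rcons !catA -rcons_cat !size_cons_cat !addnS -!addSn !addnA.
exact: exec_s.
Qed.

Lemma exec_copy_row s a v i l r p w : reads v i (code_row s) ->
  let u := code_row s in
  exec y copy_row (Store a v i [:: l; r; 0; p] w)
    (Store a v (i + size u) [:: l; r; 0; p + size u]
       (w ++ true :: code_row (spread_row l r s))).
Proof.
move=> input u; rewrite -cat_rcons; apply: ExecSeq (ExecDo _ _ _) _.
apply: ExecSeq (exec_copy_entries _ _ _ _ _ input) _.
apply: ExecSeq (ExecDo _ _ _) _; apply: exec_do.
by rewrite /= /u !code_seqE size_rcons !addnS rcons_cat.
Qed.

Lemma exec_copy_more_rows s a v i l r w :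
  let u := code_row s in reads v i u ->
  exec y (While (Count right) (Do (Inc left) ;; rewind ;; copy_row))
    (Store a v (i + size u) [:: l; r; 0; size u] w)
    (Store a v (i + size u) [:: l + r; 0; 0; size u]
       (w ++ code_body code_row
               [seq spread_row j (l + r - j) s | j <- iota l.+1 r])).
Proof.
move=> u input; elim: r l w => [|r IH] l w.
  by rewrite cats0 addn0; exact: ExecWhileFalse.
rewrite -addSnnS /= addKn code_body_cons -cat_cons catA.
apply: ExecWhileTrue _ _ (IH _ _) => //.
apply: ExecSeq (ExecDo _ _ _) _; apply: ExecSeq (exec_rewind _ _ _ _ _ _ _ _) _.
exact: (exec_copy_row _ _ _ 0 _ input).
Qed.

Lemma exec_copy_rows s a v i r w : reads v i (code_row s) ->
  exec y copy_rows (Store a v i [:: 0; r; 0; 0] w)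
    (Store a v (i + size (code_row s)) [:: 0; r; 0; 0]
       (w ++ code_body code_row
               [seq spread_row j (r - j) s | j <- iota 0 r.+1])).
Proof.
move=> input; rewrite [iota 0 _]/= [map _ _]/= subn0.
rewrite code_body_cons -cat_cons catA.
apply: ExecSeq (exec_copy_row _ _ _ 0 _ input) _.
apply: ExecSeq (exec_copy_more_rows _ 0 _ _ input) _.
apply: ExecSeq (exec_drain _ _ _ _ _ _ _ _) _.
exact: exec_transfer.
Qed.

Lemma exec_tensor_matrix rows a v i k w :
  let u := code_rows rows in reads v i u ->
  exec y tensor_matrix (Store a v i [:: 0; k; 0; 0] w)
    (Store a v (i + size u) [:: 0; k; 0; 0]
       (w ++ code_rows (spread_rows k rows))).
Proof.
move=> /= input; rewrite code_seqE -rcons_cat.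
apply: (ExecSeq (s2 := Store a v
  (i + size (code_rows rows)) [:: 0; k; 0; 0]
  (w ++ code_body code_row (spread_rows k rows))));
  last exact: exec_do.
elim: rows i w input => [|s rows IH] i w.
  by move=> [e _]; rewrite cats0 addn1; apply: ExecWhileFalse; rewrite /= e.
rewrite code_seq_cons => /reads_cons[e /reads_cat[read_s read_rows]].
rewrite [spread_rows _ _]/= code_body_cat catA size_cons_cat addnS -addSn addnA.
apply: ExecWhileTrue _ (exec_copy_rows _ _ _ read_s) (IH _ _ read_rows).
by rewrite /= e.
Qed.

End TensorProgram.

Definition tensor_machine (U : machine) : machine :=
  host U (tensor_setup ;; While Always tensor_matrix).

Lemma tensor_machine_emits U m rest p (rows : nat -> seq (seq (rat * rat))) :
  let y := code_nat m ++ rest in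
  let stream f l := flatten [seq code_rows (f i) | i <- iota 0 l] in
  (forall l, emits U y p (stream rows l)) ->
  forall l, emits (tensor_machine U) y p
    (stream (fun i => spread_rows (2 ^ m).-1 (rows i)) l).
Proof.
move=> y stream emits_rows l; pose k := (2 ^ m).-1.
pose s_ l := Store 0 (out_stream U y p) (size (stream rows l)) [:: 0; k; 0; 0]
  (stream (fun i => spread_rows k (rows i)) l).
have streamS f j : stream f j.+1 = stream f j ++ code_rows (f j).
  by rewrite /stream -addn1 iotaD map_cat flatten_cat /= cats0.
apply: (host_emits (s_ := s_) _ streaming_tensor_matrix _ (erefl (s_ 0)))
  => [|j].
  by apply: exec_tensor_setup; exact: reads_onth0.
rewrite /s_ !streamS size_cat; apply: exec_tensor_matrix.
by have := reads_out_stream (emits_rows j.+1); rewrite streamS => /reads_cat[].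
Qed.

Local Open Scope classical_set_scope.
Local Open Scope ring_scope.

(** * The matrix A (x) I *)

Lemma allpairs_iota (p q : nat) :
  [seq (x * q + a)%N | x <- iota 0 p, a <- iota 0 q] = iota 0 (p * q).
Proof.
elim: p => [|p IH]; first by rewrite mul0n.
rewrite mulSnr iotaD -IH -addn1 iotaD allpairs_cat /= cats0 !add0n.
by rewrite -[in RHS](addn0 (p * q)%N) iotaDl.
Qed.

Lemma enum_mxtens_index p q :
  enum 'I_(p * q) = [seq mxtens_index (i, a) | i <- enum 'I_p, a <- enum 'I_q].
Proof.
apply: (inj_map val_inj); rewrite val_enum_ord map_allpairs -allpairs_iota.
by rewrite -(val_enum_ord p) -(val_enum_ord q) allpairs_mapl allpairs_mapr.
Qed.

Lemma mxvec_indexE p q (i : 'I_p) (a : 'I_q) :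
  mxvec_index i a = mxtens_index (i, a).
Proof.
have enum_pairs :
    map (@mxtens_index p q) (enum {: 'I_p * 'I_q}) = enum 'I_(p * q).
  rewrite enumT Finite.enum.unlock /= /prod_enum map_allpairs.
  by rewrite enum_mxtens_index.
have lt_rank : (enum_rank (i, a) < p * q)%N.
  by rewrite (leq_trans (ltn_ord _)) // card_prod !card_ord.
rewrite -[in RHS](nth_enum_rank (i, a) (i, a)); apply: val_inj.
rewrite -(nth_map _ (mxtens_index (i, a))) -?cardE ?ltn_ord //.
by rewrite enum_pairs [RHS]nth_enum_ord.
Qed.

Lemma sum_mxtens_index (V : nmodType) p q (F : 'I_(p * q) -> V) :
  \sum_k F k = \sum_i \sum_a F (mxtens_index (i, a)).
Proof.
rewrite pair_big (reindex (@mxtens_index p q)) /=.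
  by apply: eq_bigr => -[].
exists (@mxtens_unindex p q) => k _; first exact: mxtens_indexK.
exact: mxtens_unindexK.
Qed.

Lemma tensmx1E (R : pzRingType) p q (A : 'M[R]_p) i j (a b : 'I_q) :
  (A *t 1%:M) (mxtens_index (i, a)) (mxtens_index (j, b)) =
  if a == b then A i j else 0.
Proof. by rewrite tensmxE mxE; case: eqP; rewrite ?mulr1 ?mulr0. Qed.

Definition mxrows (T : Type) (p : nat) (A : 'M[T]_p) : seq (seq T) :=
  [seq [seq A i j | j <- enum 'I_p] | i <- enum 'I_p].

Lemma map_pred1_enum (T : Type) (x y : T) (q : nat) (a : 'I_q) :
  [seq if a == b then x else y | b <- enum 'I_q] =
  nseq a y ++ x :: nseq (q.-1 - a) y.
Proof.
have size_q : (a + (q.-1 - a).+1)%N = q.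
  by case: q a => [[]|q'] a //=; rewrite addnS subnKC // -ltnS.
apply: (@eq_from_nth _ y) => [|i].
  by rewrite size_map size_cat /= !size_nseq size_enum_ord size_q.
rewrite size_map size_enum_ord => lt_iq.
rewrite (nth_map a) ?size_enum_ord // -val_eqE /= nth_enum_ord //.
rewrite nth_cat size_nseq nth_nseq.
case: ltngtP => // [lt_ai|->]; last by rewrite subnn.
have /prednK <- : (0 < i - a)%N by rewrite subn_gt0.
by rewrite /= nth_nseq if_same.
Qed.

Lemma mxrows_tensmx1 p q (A : 'M[rat * rat]_p) : (0 < q)%N ->
  mxrows (A *t (1%:M : 'M[_]_q)) = spread_rows q.-1 (mxrows A).
Proof.
move=> q_gt0; rewrite /mxrows /spread_rows prednK // -[in RHS]map_comp.
rewrite enum_mxtens_index map_allpairs.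
congr flatten; apply: eq_map => i; rewrite [RHS]/=.
rewrite -val_enum_ord -[RHS]map_comp; apply: eq_map => a.
rewrite [RHS]/= /spread_row -[in RHS]map_comp map_allpairs.
congr flatten; apply: eq_map => j; rewrite [RHS]/= -map_pred1_enum.
by apply: eq_map => b; exact: tensmx1E.
Qed.

Section TensorQuantum.
Variable R : realType.

Lemma hermsymP p (A : 'M[R[i]]_p) :
  A \is hermsymmx <-> forall i j, A i j = Num.conj (A j i).
Proof.
split=> [/is_hermitianmxP h i j|h]; first by rewrite [in LHS]h !mxE expr0 mul1r.
by apply/is_hermitianmxP/matrixP => i j; rewrite h !mxE expr0 mul1r.
Qed.

Lemma psdmx_tensmx1 p q (A : 'M[R[i]]_p) :
  psdmx A -> psdmx (A *t (1%:M : 'M[_]_q)).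
Proof.
move=> [/hermsymP herm_A pos_A]; split.
  apply/hermsymP => k l.
  case: (mxtens_indexP k) => i a; case: (mxtens_indexP l) => j b.
  by rewrite !tensmx1E eq_sym; case: eqP => _; rewrite ?conjC0 // herm_A.
move=> v; rewrite mxE sum_mxtens_index exchange_big /=; apply: sumr_ge0 => b _.
have := pos_A (\row_i v 0 (mxtens_index (i, b))); rewrite mxE.
congr (0 <= _); apply: eq_bigr => j _; rewrite !mxE; congr (_ * _).
rewrite sum_mxtens_index; apply: eq_bigr => i _; rewrite mxE.
rewrite (bigD1 b) //= tensmx1E eqxx big1 ?addr0 // => a nab.
by rewrite tensmx1E (negbTE nab) mulr0.
Qed.

Lemma elementary_tensmx1 p q (A : 'M[rat * rat]_p) :
  elementary_mx R (A *t (1%:M : 'M[_]_q)) = elementary_mx R A *t 1%:M.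
Proof.
apply/matrixP => k l.
case: (mxtens_indexP k) => i a; case: (mxtens_indexP l) => j b.
by rewrite mxE !tensmx1E mxE; case: eqP => //= _; rewrite raddf0.
Qed.

Lemma mx_cvg_tensmx1 p q (s : nat -> 'M[R[i]]_p) A :
  mx_cvg s A -> mx_cvg (fun l => s l *t (1%:M : 'M[_]_q)) (A *t 1%:M).
Proof.
move=> cvg_s k l.
case: (mxtens_indexP k) => i a; case: (mxtens_indexP l) => j b.
rewrite tensmx1E; under [X in X @ _ --> _ /\ _]eq_fun do rewrite tensmx1E.
under [X in _ /\ X @ _ --> _]eq_fun do rewrite tensmx1E.
by case: eqP => _; [exact: cvg_s|split; exact: cvg_cst].
Qed.

Lemma tensmx1B p q (A B : 'M[R[i]]_p) :
  A *t (1%:M : 'M[_]_q) - B *t 1%:M = (A - B) *t 1%:M.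
Proof. by apply/matrixP => k l; rewrite !mxE mulrBl. Qed.

Section PartialTrace.
Variables (m n : nat) (le_mn : (m <= n)%N).

Definition tensor_id (A : 'M[R[i]]_(2 ^ (n - m))) : 'M[R[i]]_(2 ^ n) :=
  castmx (tensor_dim le_mn, tensor_dim le_mn) (A *t (1%:M : 'M[_]_(2 ^ m))).

Lemma tensor_idE A i a j b :
  tensor_id A (tensor_index le_mn i a) (tensor_index le_mn j b) =
  if a == b then A i j else 0.
Proof. by rewrite castmxE /tensor_index !cast_ordK !mxvec_indexE tensmx1E. Qed.

Lemma tensor_id_inj : injective tensor_id.
Proof.
move=> A B eAB; apply/matrixP => i j.
have a : 'I_(2 ^ m) by exact: Ordinal (expn_gt0 2 m).
by have := tensor_idE A i a j a; rewrite eAB tensor_idE eqxx.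
Qed.

Lemma sum_tensor_index (V : nmodType) (F : 'I_(2 ^ n) -> V) :
  \sum_k F k = \sum_i \sum_a F (tensor_index le_mn i a).
Proof.
rewrite (reindex (cast_ord (tensor_dim le_mn))) /=; last first.
  exists (cast_ord (esym (tensor_dim le_mn))) => k _; first exact: cast_ordK.
  exact: cast_ordKV.
rewrite sum_mxtens_index; apply: eq_bigr => i _; apply: eq_bigr => a _.
by rewrite /tensor_index mxvec_indexE.
Qed.

Lemma trace_tensor_id A B :
  \tr (tensor_id A *m B) = \tr (A *m partial_trace le_mn B).
Proof.
rewrite /mxtrace sum_tensor_index; apply: eq_bigr => i _.
under eq_bigr => a _ do rewrite mxE sum_tensor_index.
rewrite mxE exchange_big /=; apply: eq_bigr => j _.
rewrite mxE mulr_sumr; apply: eq_bigr => a _.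
rewrite (bigD1 a) //= tensor_idE eqxx big1 ?addr0 // => b nab.
by rewrite tensor_idE eq_sym (negbTE nab) mul0r.
Qed.

End PartialTrace.
End TensorQuantum.

(** * Traces of products of positive semidefinite matrices *)

Section PsdTrace.
Variables (R : realType) (p : nat).
Implicit Types A B : 'M[R[i]]_p.

Lemma psdmx_trace_mul_ge0 A B : psdmx A -> psdmx B -> 0 <= \tr (A *m B).
Proof.
move=> [_ pos_A] [herm_B pos_B].
pose P := spectralmx B; pose d := spectral_diag B.
have P_unit : P \in unitmx by apply: unitarymx_unit; exact: spectral_unitarymx.
have eB : B = invmx P *m diag_mx d *m P.
  by apply/orthomx_spectralP; exact: hermitian_normalmx.
have conj_diag (C : 'M[R[i]]_p) i :
    (P *m C *m invmx P) i i = (row i P *m C *m map_mx Num.conj (row i P)^T) 0 0.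
  rewrite invmx_unitary ?spectral_unitarymx // -row_mul !mxE.
  by apply: eq_bigr => j _; rewrite !mxE.
have d_ge0 i : 0 <= d 0 i.
  have -> : d 0 i = (P *m B *m invmx P) i i.
    by rewrite eB !mulmxA mulmxV // mul1mx -mulmxA mulmxV // mulmx1 mxE eqxx.
  by rewrite conj_diag; exact: pos_B.
rewrite eB !mulmxA mxtrace_mulC !mulmxA; apply: sumr_ge0 => i _.
by rewrite mul_mx_diag mxE mulr_ge0 // conj_diag; exact: pos_A.
Qed.

Lemma Re_sum (I : Type) (r : seq I) (F : I -> R[i]) :
  complex.Re (\sum_(i <- r) F i) = \sum_(i <- r) complex.Re (F i).
Proof. by apply: (big_morph (@complex.Re R)) => // -[? ?] [? ?]. Qed.

Lemma cvg_Re_trace (s : nat -> 'M[R[i]]_p) A B : mx_cvg s A ->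
  (fun l => complex.Re (\tr (s l *m B))) @ \oo --> complex.Re (\tr (A *m B)).
Proof.
move=> cvg_s.
have Re_trace (C : 'M[R[i]]_p) : complex.Re (\tr (C *m B)) =
    \sum_i \sum_j (complex.Re (C i j) * complex.Re (B j i) -
                   complex.Im (C i j) * complex.Im (B j i)).
  rewrite /mxtrace Re_sum; apply: eq_bigr => i _.
  rewrite mxE Re_sum; apply: eq_bigr => j _.
  by case: (C i j) => ? ?; case: (B j i).
rewrite Re_trace; under eq_fun do rewrite Re_trace.
apply: cvg_big => [|i _]; first exact: add_continuous.
apply: cvg_big => [|j _]; first exact: add_continuous.
by apply: cvgB; apply: cvgMl; have [] := cvg_s i j.
Qed.

Lemma Re_trace_lower_ge0 U e q A B :
  lower_computes U e q A -> psdmx B -> 0 <= complex.Re (\tr (A *m B)).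
Proof.
move=> [s [_ psd_s _ cvg_s]] psd_B; have cvg_tr := cvg_Re_trace (B := B) cvg_s.
rewrite -(cvg_lim (@Rhausdorff R) cvg_tr).
apply: limr_ge; first by apply/cvg_ex; eexists; exact: cvg_tr.
apply: nearW => l; have := psdmx_trace_mul_ge0 (psd_s l) psd_B.
by rewrite lecE => /andP[].
Qed.

End PsdTrace.

(** * Universal probabilities *)

Lemma le_esum_inj (R : realType) (T T' : choiceType) (P : set T) (Q : set T')
    (f : T -> T') (a : T -> \bar R) (b : T' -> \bar R) (C : R) :
  0 <= C -> injective f -> (forall i, P i -> Q (f i)) ->
  (forall i, P i -> 0 <= b (f i))%E ->
  (forall i, P i -> a i <= C%:E * b (f i))%E ->
  (\esum_(i in P) a i <= C%:E * \esum_(j in Q) b j)%E.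
Proof.
move=> C0 f_inj PQ b0 ab; apply: ge_ereal_sup => _ [X [finX XP] <-].
apply: (@le_trans _ _ (\sum_(i \in X) C%:E * b (f i))%E).
  by apply: lee_fsum => // i /XP; exact: ab.
have -> : (\sum_(i \in X) C%:E * b (f i) = C%:E * \sum_(i \in X) b (f i))%E.
  rewrite !fsbig_finite // big_seq [in RHS]big_seq ge0_sume_distrr // => i.
  by rewrite in_fset_set // inE => /XP; exact: b0.
apply: lee_wpmul2l; first by rewrite lee_fin.
apply: ereal_sup_ubound; exists (f @` X).
  by split; [exact: finite_image|move=> _ [i /XP /PQ Qi <-]].
by rewrite fsbig_image // => i j _ _; exact: f_inj.
Qed.

Lemma cat_inj (T : eqType) (s : seq T) : injective (cat s).
Proof. by move=> u v /eqP; rewrite eqseq_cat // eqxx => /eqP. Qed.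

Definition simulates (U T : machine) (t : seq bool) : Prop :=
  forall y p, (forall x, computes U y (t ++ p) x <-> computes T y p x) /\
              (forall w, emits U y (t ++ p) w <-> emits T y p w).

Section Probability.
Variables (R : realType) (U : machine).

Lemma lower_computes_castmx e q p p' (eq_p : p = p') (A : 'M[R[i]]_p) :
  lower_computes U e q A -> lower_computes U e q (castmx (eq_p, eq_p) A).
Proof. by case: _ / eq_p; rewrite castmx_id. Qed.

Lemma lower_computes_tensmx1 t m rest q p (A : 'M[R[i]]_p) :
  let e := code_nat m ++ rest in
  simulates U (tensor_machine U) t -> lower_computes U e q A ->
  lower_computes U e (t ++ q) (A *t (1%:M : 'M[_]_(2 ^ m))).
Proof.
move=> e sim_t [s [emits_s psd_s mono_s cvg_s]].
exists (fun l => s l *t 1%:M); split.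
- move=> l; apply/(sim_t e q).2.
  have := @tensor_machine_emits U m rest q (fun i => mxrows (s i)) emits_s l.
  by under eq_map do rewrite -mxrows_tensmx1 ?expn_gt0 //.
- by move=> l; rewrite elementary_tensmx1; exact: psdmx_tensmx1.
- by move=> l; rewrite !elementary_tensmx1 tensmx1B; exact: psdmx_tensmx1.
- under [X in mx_cvg X]eq_fun do rewrite elementary_tensmx1.
  exact: mx_cvg_tensmx1.
Qed.

Local Open Scope ereal_scope.

Lemma univ_prob_ge0 x y : 0 <= univ_prob R U x y.
Proof. by apply: esum_ge0 => p _; rewrite lee_fin invr_ge0 exprn_ge0. Qed.

Lemma lower_prob_ge0 e p (A : 'M[R[i]]_p) y : 0 <= lower_prob U e A y.
Proof. by apply: esum_ge0 => q _; exact: univ_prob_ge0. Qed.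

Lemma le_univ_prob_cat t x x' y y' :
  (forall p, computes U y p x -> computes U y' (t ++ p) x') ->
  univ_prob R U x y <= (2 ^+ size t)%:E * univ_prob R U x' y'.
Proof.
move=> xx'; apply: (le_esum_inj (f := cat t)) => //.
- exact: cat_inj.
- by move=> p _; rewrite -EFinM lee_fin size_cat exprD invfM mulrA mulfV ?mul1r.
Qed.

Lemma le_lower_prob_cat t s e y y' p p' (A : 'M[R[i]]_p) (A' : 'M[R[i]]_p') :
  (forall q, lower_computes U e q A -> lower_computes U e (s ++ q) A') ->
  (forall q r, computes U (e ++ y) r q ->
     computes U (e ++ y') (t ++ r) (s ++ q)) ->
  lower_prob U e A y <= (2 ^+ size t)%:E * lower_prob U e A' y'.
Proof.
move=> AA' yy'; apply: (le_esum_inj (f := cat s)) => //.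
- exact: cat_inj.
- by move=> q _; exact: univ_prob_ge0.
- by move=> q _; apply: le_univ_prob_cat => r; exact: yy'.
Qed.

Lemma trace_test_ge0 e k (sigma rho : 'M[R[i]]_(2 ^ k)) :
  0 <= trace_test U e sigma rho.
Proof.
apply: ereal_sup_ubound; exists set0; first exact: fsets_set0.
by rewrite fsbig_set0.
Qed.

Section ReducedState.
Variables (t_aux t_tensor : seq bool) (m n : nat) (le_mn : (m <= n)%N).
Hypothesis sim_aux : simulates U (aux_machine U t_tensor) t_aux.
Hypothesis sim_tensor : simulates U (tensor_machine U) t_tensor.
Let e := code_nat m ++ code_nat n.

Lemma lower_computes_tensor_id q (nu : 'M[R[i]]_(2 ^ (n - m))) :
  lower_computes U e q nu ->
  lower_computes U e (t_tensor ++ q) (tensor_id le_mn nu).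
Proof.
move=> low_q; apply: lower_computes_castmx; exact: lower_computes_tensmx1.
Qed.

Lemma lower_prob_tensor_id (nu : 'M[R[i]]_(2 ^ (n - m))) :
  lower_prob U e nu (code_nat (n - m)) <=
  (2 ^+ size t_aux)%:E * lower_prob U e (tensor_id le_mn nu) (code_nat n).
Proof.
apply: (le_lower_prob_cat (s := t_tensor)) => [q|q p comp_p].
  exact: lower_computes_tensor_id.
by apply/(sim_aux _ _).1; exact: aux_machine_computes.
Qed.

Lemma trace_test_partial_trace (sigma rho : 'M[R[i]]_(2 ^ n)) : psdmx sigma ->
  trace_test U e (partial_trace le_mn sigma) (partial_trace le_mn rho) <=
  (2 ^+ size t_aux)%:E * trace_test U e sigma rho.
Proof.
move=> psd_sigma.
have trace_ge0 nu : tests U e (partial_trace le_mn rho) nu ->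
    (0 <= complex.Re (\tr (tensor_id le_mn nu *m sigma)))%R.
  move=> [[q low_q] _].
  exact: Re_trace_lower_ge0 (lower_computes_tensor_id low_q) psd_sigma.
apply: (le_esum_inj (f := tensor_id le_mn)) => //.
- exact: tensor_id_inj.
- move=> nu [[q low_q] tr_nu]; split; last by rewrite trace_tensor_id.
  by exists (t_tensor ++ q); exact: lower_computes_tensor_id.
- by move=> nu /trace_ge0 ?; rewrite mule_ge0 ?lee_fin // lower_prob_ge0.
- move=> nu /trace_ge0 tr_ge0; rewrite -trace_tensor_id muleA.
  by apply: lee_wpmul2r; [rewrite lee_fin|exact: lower_prob_tensor_id].
Qed.

End ReducedState.
End Probability.

Lemma lne_div_ln_leD (R : realType) (b : R) (k : nat) (x y : \bar R) :
  1 < b -> (0 <= x)%E -> (0 <= y)%E -> (x <= (b ^+ k)%:E * y)%E ->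
  (lne x * (ln b)^-1%:E <= lne y * (ln b)^-1%:E + k%:R%:E)%E.
Proof.
move=> b_gt1 x0 y0 le_xy; have b_gt0 : 0 < b by exact: lt_trans ltr01 b_gt1.
have lnb_gt0 : 0 < ln b by rewrite ln_gt0.
have : (lne x <= lne ((b ^+ k)%:E * y))%E.
  rewrite lee_lne // in_itv /= leey andbT ?mule_ge0 // lee_fin.
  by rewrite exprn_ge0 // ltW.
have [->|y_neq0] := eqVneq y 0%E.
  rewrite mule0 [lne 0%E]le0_lneNy // leeNy_eq => /eqP ->.
  by rewrite mulNyr gtr0_sg ?invr_gt0 // mul1e.
have y_gt0 : (0 < y)%E by rewrite lt_neqAle eq_sym y_neq0.
have pos_itv (z : \bar R) : (0 < z)%E -> z \in `]0%E, +oo%E].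
  by rewrite in_itv /= leey andbT.
rewrite lneM ?pos_itv ?lte_fin ?exprn_gt0 //.
rewrite lne_EFin ?exprn_gt0 // lnXn // => le_ln.
have -> : k%:R%:E = ((ln b *+ k)%:E * (ln b)^-1%:E)%E.
  by rewrite -EFinM -[ln b *+ k]mulr_natl mulfK // gt_eqF.
rewrite addeC -muleDl //.
by apply: lee_wpmul2r le_ln; rewrite lee_fin invr_ge0 ltW.
Qed.

Theorem theorem3 (R : realType) (U : machine) (univU : universal U) :
  exists c : R, forall (m n : nat) (lt_mn : (m < n)%N)
    (sigma rho : 'M[R[i]]_(2 ^ n)),
    semidensity sigma -> semidensity rho ->
    (deficiency U (code_nat m ++ code_nat n)
       (partial_trace (ltnW lt_mn) sigma) (partial_trace (ltnW lt_mn) rho)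
     <= deficiency U (code_nat m ++ code_nat n) sigma rho + c%:E)%E.
Proof.
have [t_tensor sim_tensor] := univU (tensor_machine U).
have [t_aux sim_aux] := univU (aux_machine U t_tensor).
exists (size t_aux)%:R => m n lt_mn sigma rho [psd_sigma _] _.
apply: lne_div_ln_leD; rewrite ?trace_test_ge0 ?ltr1n //.
exact: (trace_test_partial_trace _ sim_aux sim_tensor).
Qed.
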